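(* Let $q$ be a prime power, let $b\ge 1$ be an integer, and let $\mathcal{C}$ be any $(n,k,d_b)^b_q$ linear code, that is, a $k$-dimensional $\mathbb{F}_q$-linear subspace of $\mathbb{F}_q^n$ with minimum $b$-symbol distance $d_b$. Then $$\frac{(q^b-1)\,n}{q-1}\;\geq\;\sum_{i=0}^{k-1}\left\lceil\frac{q^{b-1}d_b}{q^i}\right\rceil .$$
   Context: For $\mathbf{a}=(a_0,\ldots,a_{n-1})$ and $\mathbf{c}=(c_0,\ldots,c_{n-1})$ in $\mathbb{F}_q^n$, the $b$-symbol distance is $$d_b(\mathbf{a},\mathbf{c})=\left|\{0\le i\le n-1 : (a_i,\ldots,a_{i+b-1})\neq (c_i,\ldots,c_{i+b-1})\}\right|,$$ with subscripts taken modulo $n$. An $(n,k,d_b)^b_q$ linear code is a $k$-dimensional subspace $\mathcal{C}\subseteq\mathbb{F}_q^n$ ($k\ge 1$) whose minimum $b$-symbol distance, i.e. the minimum of $d_b(\mathbf{a},\mathbf{c})$ over distinct $\mathbf{a},\mathbf{c}\in\mathcal{C}$, equals $d_b$. *)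

(* Defs.v *)
From HB Require Import structures.
From mathcomp Require Import all_boot all_order all_algebra all_field.

Set Implicit Arguments.
Unset Strict Implicit.
Unset Printing Implicit Defensive.

Import Order.TTheory GRing.Theory Num.Theory.
Local Open Scope ring_scope.

(* The index (i + j) mod n; n > 0 because 'I_n is inhabited by i. *)
Definition cyc_add (n : nat) (i : 'I_n) (j : nat) : 'I_n :=
  Ordinal (ltn_pmod (i + j) (leq_ltn_trans (leq0n i) (ltn_ord i))).

(* (a_i, ..., a_{i+b-1}), with b allowed to exceed n. *)
Definition bwindow (F : finFieldType) (n b : nat) (a : 'rV[F]_n) (i : 'I_n) :
    b.-tuple F :=
  [tuple a ord0 (cyc_add i j) | j < b].

Definition bdist (F : finFieldType) (n b : nat) (a c : 'rV[F]_n) : nat :=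
  #|[set i : 'I_n | bwindow b a i != bwindow b c i]|.

Definition is_min_bdist (F : finFieldType) (n b : nat)
    (C : {vspace 'rV[F]_n}) (d : nat) : Prop :=
  (exists a c : 'rV[F]_n,
      [/\ a \in C, c \in C, a <> c & bdist b a c = d])
  /\ (forall a c : 'rV[F]_n,
      a \in C -> c \in C -> a <> c -> (d <= bdist b a c)%N).

Definition bsymbol_linear_code (F : finFieldType) (n k d b : nat)
    (C : {vspace 'rV[F]_n}) : Prop :=
  [/\ (1 <= k)%N, \dim C = k & is_min_bdist b C d].

(* Main.v *)
(** Fix one normal vector [y] in F^b per projective point. Mapping a codeword to the
    values [<window_i, y>] turns C into a code of length n (q^b - 1)/(q - 1) in which
    a codeword of b-symbol weight w has Hamming weight q^(b-1) w, because a nonzero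
    window is non-orthogonal to exactly q^(b-1) projective points. The bound is then
    the Griesmer bound for this code. *)
Require Import Defs.
From HB Require Import structures.
From mathcomp Require Import all_boot all_order all_algebra all_field.
From mathcomp Require Import ring zify.

Set Implicit Arguments.
Unset Strict Implicit.
Unset Printing Implicit Defensive.

Import Order.TTheory GRing.Theory Num.Theory.
Local Open Scope ring_scope.

Lemma mx11_eq0 (R : nzRingType) (A : 'M[R]_1) : (A == 0) = (A 0 0 == 0).
Proof.
apply/eqP/eqP => [->|A0]; first by rewrite mxE.
by rewrite [A]mx11_scalar A0 raddf0.
Qed.

(** The only zero is at [t = - A / B]. *)
Lemma sum_line_neq0 (F : finFieldType) (A B : 'M[F]_1) : B != 0 ->
  (\sum_(t : F) ((A + t *: B)%R != 0%R) = #|F|.-1)%N.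
Proof.
rewrite mx11_eq0 => B0.
rewrite -(cardC1 (- A 0 0 / B 0 0)) -sum1_card [RHS]big_mkcond /=.
apply: eq_bigr => t _.
rewrite mx11_eq0 !mxE addrC addr_eq0 (can2_eq (mulfK B0) (divfK B0)) !inE.
by case: eqP.
Qed.

Section Griesmer.

Variables (F : finFieldType) (n : nat).
Implicit Types (v c : 'rV[F]_n) (u : 'cV[F]_n) (s : seq 'cV[F]_n).

(* A code is given by the columns [s] of a generator matrix. *)
Definition hweight s v : nat := count (fun u => v *m u != 0) s.

Lemma sum_line_nonorthogonal v c u :
  (\sum_(a : F) ((v + a *: c)%R *m u != 0%R)
     = if c *m u == 0%R then #|F| * (v *m u != 0%R) else #|F|.-1)%N.
Proof.
under eq_bigr => a _ do rewrite mulmxDl -scalemxAl.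
case: eqP => [->|/eqP cu0]; last exact: sum_line_neq0.
under eq_bigr => a _ do rewrite scaler0 addr0.
by rewrite sum_nat_const.
Qed.

(** A column orthogonal to [c] takes the same value on the whole line [v + F c]; any other column
    vanishes at exactly one point of it. *)
Lemma sum_line_hweight s v c :
  (\sum_(a : F) hweight s (v + a *: c)%R
     = #|F| * hweight [seq u <- s | c *m u == 0%R] v + #|F|.-1 * hweight s c)%N.
Proof.
rewrite /hweight; elim: s => [|u s IH] /=.
  by rewrite big1 // !muln0.
rewrite big_split /= IH sum_line_nonorthogonal.
by case: (c *m u == 0) => /=; lia.
Qed.

(** Induction on the dimension through residual codes. [D] is rational so that the residual code
    inherits the bound [D / #|F|] without rounding, and the ceilings need not be nested. *)
Lemma griesmer (D : rat) s (C : {vspace 'rV[F]_n}) :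
    (forall v, v \in C -> v != 0 -> D <= (hweight s v)%:R) ->
  \sum_(i < \dim C) Num.ceil (D / #|F|%:R ^+ i) <= (size s)%:Z.
Proof.
move: {2}(\dim C) (erefl (\dim C)) => k.
elim: k D s C => [|k IH] D s C dC HD; first by rewrite dC big_ord0.
have C0 : C != 0%VS by rewrite -dimv_eq0 dC.
have H0 : (vpick C \in C) && (vpick C != 0) by rewrite memv_pick vpick0.
case: (arg_minnP (P := fun v => (v \in C) && (v != 0)) (hweight s) H0)
  => c /andP[cC c0] cmin.
pose C' := (C :\: <[c]>)%VS.
have dC' : \dim C' = k.
  have := dimv_cap_compl C <[c]>.
  rewrite (capv_idPr _) ?dim_vline ?c0 ?dC /C' /=; first by lia.
  by rewrite -memvE.
have F0 : (0 < #|F|%:R :> rat) by rewrite ltr0n (cardD1 0).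
(* Residual code with respect to [c] of minimum weight: average over the line
   [v + F c], all of whose words have weight at least that of [c]. *)
pose s' := [seq u <- s | c *m u == 0].
have HD' v : v \in C' -> v != 0 -> D / #|F|%:R <= (hweight s' v)%:R.
  move=> vC' v0.
  have vC : v \in C by exact: (subvP (diffvSl _ _)) vC'.
  (* [v + a *: c] is nonzero because the complement [C'] meets the line of [c] only in 0. *)
  have wt a : (hweight s c <= hweight s (v + a *: c)%R)%N.
    apply: cmin; rewrite memvD ?memvZ //=.
    apply: contraNneq v0 => /eqP; rewrite addr_eq0 => /eqP vE.
    rewrite -memv0 -(capv_diff C <[c]>%VS) memv_cap vC' /=.
    by rewrite vE -scaleNr memvZ ?memv_line.
  have : (\sum_(a : F) hweight s c <= \sum_(a : F) hweight s (v + a *: c)%R)%N.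
    by apply: leq_sum => a _; apply: wt.
  rewrite sum_nat_const sum_line_hweight -/s' => h.
  have h2 : (hweight s c <= hweight s' v * #|F|)%N.
    have : (0 < #|F|)%N by rewrite (cardD1 0).
    move: h; rewrite (_ : #|xpredT| = #|F|) //; nia.
  rewrite ler_pdivrMr // -natrM; apply: le_trans (HD _ cC c0) _.
  by rewrite ler_nat.
have := IH _ _ _ dC' HD'.
rewrite dC' dC big_ord_recl expr0 divr1 => h.
(* The columns not orthogonal to [c] pay for the term [i = 0]; the residual columns pay for the
   others, shifted by one. *)
have -> : size s = (hweight s c + size s')%N.
  by rewrite size_filter /hweight addnC count_predC.
rewrite PoszD lerD //; first by rewrite ceil_le_int //; apply: HD.
apply: le_trans h; apply: ler_sum => i _.
by rewrite lift0 exprS invfM mulrA.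
Qed.

End Griesmer.

Section ProjectivePoints.

Variable F : finFieldType.

(* Representatives of the points of P^(b-1): first nonzero entry equal to 1. *)
Fixpoint proj_points (b : nat) : seq 'cV[F]_b :=
  if b is b'.+1 then
    [seq (col_mx 1%:M y : 'cV_(1 + b')) | y <- enum 'cV[F]_b'] ++
    [seq (col_mx 0 y : 'cV_(1 + b')) | y <- proj_points b']
  else [::].

Lemma size_proj_points b : (#|F|.-1 * size (proj_points b) + 1 = #|F| ^ b)%N.
Proof.
have F0 : (0 < #|F|)%N by rewrite (cardD1 0).
elim: b => [|b IH]; first by rewrite muln0.
have E : size (enum 'cV[F]_b) = (#|F| ^ b)%N by rewrite -cardT card_mx muln1.
rewrite /= size_cat !size_map -enumT E mulnDr -addnA IH expnS.
by rewrite -mulSnr prednK.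
Qed.

(** The constant [a] arises from the projective points with first entry 1, on which a linear form
    becomes affine. *)
Lemma card_affine_nonzero b (x : 'rV[F]_b) (a : 'M[F]_1) : x != 0 ->
  (#|[pred y : 'cV[F]_b | (a + x *m y)%R != 0%R]| + #|F| ^ b.-1 = #|F| ^ b)%N.
Proof.
case: b x => [|b] x x0; first by rewrite thinmx0 eqxx in x0.
have [j xj] := rV0Pn _ x0.
pose e : 'cV[F]_b.+1 := delta_mx j 0.
have F0 : (0 < #|F|)%N by rewrite (cardD1 0).
(* every line in direction [e] meets the hyperplane [a + x y = 0] once *)
have line y : (\sum_(t : F) ((a + x *m (y + t *: e))%R != 0%R) = #|F|.-1)%N.
  under eq_bigr => t _ do rewrite mulmxDr -scalemxAr addrA.
  apply: sum_line_neq0; rewrite -colE; apply: contraNneq xj => xj0.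
  by have /matrixP/(_ 0 0) := xj0; rewrite !mxE => ->.
have : (\sum_(y : 'cV[F]_b.+1) \sum_(t : F) ((a + x *m (y + t *: e))%R != 0%R)
        = #|F| ^ b.+1 * #|F|.-1)%N.
  under eq_bigr => y _ do rewrite line.
  by rewrite sum_nat_const card_mx muln1.
rewrite exchange_big /=.
(* For fixed [t], translation by [t *: e] permutes the space, so the inner sum is independent of
   [t]. *)
under eq_bigr => t _.
  rewrite -(reindex_inj (h := fun y => y + t *: e) (P := xpredT)
     (F := fun y => nat_of_bool ((a + x *m y)%R != 0%R)) (@addIr _ (t *: e))) /=.
  rewrite -big_mkcond /= sum1_card.
  over.
rewrite sum_nat_const expnS /= (_ : #|xpredT| = #|F|) //.
rewrite -mulnA => /eqP; rewrite eqn_pmul2l // => /eqP h.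
transitivity (#|F| ^ b * #|F|.-1 + #|F| ^ b)%N; first by rewrite -h.
by rewrite mulnC -mulSnr prednK.
Qed.

(** Split [x] as [(x0, x')]. If [x'] is nonzero, the points with first entry 1 give [q^b - q^(b-1)]
    and those at infinity [q^(b-1)], where [b] is the length of [x']. If [x' = 0], only the former
    can count, all or none according to [x0]. *)
Lemma count_proj_points b (x : 'rV[F]_b) :
  count (fun y => x *m y != 0) (proj_points b)
    = (if x == 0%R then 0 else #|F| ^ b.-1)%N.
Proof.
elim: b x => [|b IH] x; first by rewrite thinmx0 eqxx.
rewrite -[x](@hsubmxK _ 1 1 b).
set x0 := lsubmx _; set x' := rsubmx _.
rewrite count_cat !count_map.
have Erow (z : 'M_1) y : row_mx x0 x' *m col_mx z y = x0 *m z + x' *m y.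
  exact: mul_row_col.
rewrite (@eq_count _ _ (fun y => x0 + x' *m y != 0)); last first.
  by move=> y; rewrite -[X in X + _](mulmx1 x0) -Erow.
rewrite [X in (_ + X)%N](@eq_count _ _ (fun y => x' *m y != 0)); last first.
  by move=> y; rewrite -[X in X != 0]add0r -[X in X + _](mulmx0 _ x0) -Erow.
have count_enum (P : pred 'cV[F]_b) : count P (enum 'cV[F]_b) = #|P|.
  by rewrite cardE -size_filter enumT /enum_mem.
rewrite IH -enumT count_enum.
have -> : (row_mx x0 x' == 0) = (x0 == 0) && (x' == 0).
  apply/eqP/andP => [|[/eqP-> /eqP->]]; last exact: row_mx0.
  by rewrite -[0 in X in X -> _](row_mx0 _ 1 1 b) => /eq_row_mx[-> ->].
have [->|x'0] := eqVneq x' 0; last first.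
  by rewrite andbF; exact: card_affine_nonzero.
rewrite andbT addn0.
have E y : y \in (fun y : 'cV_b => x0 + 0 *m y != 0) = (x0 != 0).
  by rewrite unfold_in mul0mx addr0.
case: eqP => [x00|/eqP x00].
  by apply: eq_card0 => y; rewrite E x00 eqxx.
by rewrite eq_cardT => [|y]; rewrite ?E // -cardT card_mx muln1.
Qed.

End ProjectivePoints.

Section BSymbol.

Variables (F : finFieldType) (n b : nat).

Definition window_mx (i : 'I_n) : 'M[F]_(n, b) :=
  \matrix_(l, j) (l == cyc_add i j)%:R.

Lemma mulmx_window (a : 'rV[F]_n) i :
  a *m window_mx i = \row_j a 0 (cyc_add i j).
Proof.
apply/rowP => j; rewrite !mxE (bigD1 (cyc_add i j)) //= mxE eqxx mulr1.
by rewrite big1 ?addr0 // => l /negPf ne; rewrite mxE ne mulr0.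
Qed.

Lemma bwindow_eq0 (a : 'rV[F]_n) i :
  (bwindow b a i == bwindow b 0 i) = (a *m window_mx i == 0).
Proof.
rewrite mulmx_window; apply/eqP/eqP => [h|h].
  apply/rowP => j; have := congr1 (fun t => tnth t j) h.
  by rewrite !tnth_mktuple !mxE.
apply: eq_from_tnth => j; have /rowP/(_ j) := h.
by rewrite !tnth_mktuple !mxE.
Qed.

Definition bsymbol_columns : seq 'cV[F]_n :=
  [seq window_mx i *m y | i <- enum 'I_n, y <- proj_points F b].

Lemma hweight_bsymbol_columns (a : 'rV[F]_n) :
  hweight bsymbol_columns a = (#|F| ^ b.-1 * bdist b a 0)%N.
Proof.
rewrite /hweight /bsymbol_columns count_flatten sumnE 2!big_map big_enum /=.
rewrite /bdist -sum1_card big_distrr /= [RHS]big_mkcond /=.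
apply: eq_bigr => i _; rewrite inE bwindow_eq0 count_map.
under eq_count => y do rewrite /= mulmxA.
by rewrite count_proj_points muln1; case: eqP.
Qed.

End BSymbol.

Theorem theorem1 (q : nat) (F : finFieldType) (hq : #|F| = q)
    (b : nat) (hb : (1 <= b)%N) (n k d : nat) (C : {vspace 'rV[F]_n})
    (hC : bsymbol_linear_code k d b C) :
  (\sum_(i < k) Num.ceil (q%:R ^+ (b - 1) * d%:R / q%:R ^+ i : rat))%:~R
    <= (q%:R ^+ b - 1) * n%:R / (q%:R - 1) :> rat.
Proof.
case: hC => _ <- [_ dmin].
have q1 : (1 < q)%N by rewrite -hq finNzRing_gt1.
have wt v : v \in C -> v != 0 ->
    q%:R ^+ (b - 1) * d%:R <= (hweight (bsymbol_columns F n b) v)%:R :> rat.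
  move=> vC v0; rewrite hweight_bsymbol_columns hq subn1 -natrX -natrM ler_nat.
  (* The weight is a distance to the codeword 0. *)
  by rewrite leq_mul2l dmin ?orbT ?mem0v //; apply/eqP.
have := griesmer wt; rewrite hq -(ler_int rat) => /le_trans; apply.
(* Only the length remains to be computed; after clearing [q - 1] the inequality is an equality. *)
rewrite ler_pdivlMr ?subr_gt0 ?ltr1n // size_allpairs size_enum_ord.
have := size_proj_points F b; rewrite hq => /(congr1 (fun m => m%:R : rat)).
rewrite natrD natrM natrX -subn1 natrB 1?ltnW // => <-.
by rewrite -pmulrn natrM le_eqVlt; apply/orP; left; apply/eqP; ring.
Qed.
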